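(* For every integer $k\geq 2$, the sumset $S(k)+S(k)=\{c+b: c,b\in S(k)\}$ contains the interval $\left[0,\frac{1}{k-1}\right]$. Consequently, $\lambda\bigl(S(k)+S(k)\bigr)\geq \frac{1}{k-1}$ for all $k\geq 2$, where $\lambda$ denotes Lebesgue measure.
   Context: For $x\in[0,1]$ write its regular continued fraction $x=[a_1,a_2,\ldots]=\cfrac{1}{a_1+\cfrac{1}{a_2+\cdots}}$ with $a_i\in\mathbb{Z}_{>0}$, and let $a_n(x)$ denote its $n$-th partial quotient. Rationals are written with finite expansions whose last partial quotient is at least $2$ (and $1=[1]$). For an integer $k\geq1$, $S(k)=\{x\in[0,1]: a_n(x)\geq k \text{ for all } n\}$, where a rational number belongs to $S(k)$ if all its (finitely many) defined partial quotients are $\geq k$, and $0$ is included in $S(k)$ (thought of as $0=1/\infty$). *)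

(* Defs.v *)
From mathcomp Require Import all_boot all_order all_algebra.
From mathcomp Require Import all_classical all_reals all_analysis.

Set Implicit Arguments.
Unset Strict Implicit.
Unset Printing Implicit Defensive.

Import Order.TTheory GRing.Theory Num.Theory.
Import numFieldNormedType.Exports.

Local Open Scope classical_set_scope.
Local Open Scope ring_scope.

(* [a_1, ..., a_n] = 1 / (a_1 + 1 / (... + 1 / a_n)).  The empty fraction
   is 0, in accordance with 0 = 1 / oo. *)
Fixpoint cfrac (R : realType) (s : seq nat) : R :=
  if s is a :: s' then (a%:R + cfrac R s')^-1 else 0.

(* The condition on the last partial quotient is the normalisation that makes
   finite expansions unique: the last one is at least 2, except in 1 = [1].
   The default value 2 of last only serves the empty expansion of 0. *)
Definition finite_regular_cf (R : realType) (s : seq nat) (x : R) : Prop :=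
  [/\ all (fun a => 0 < a)%N s,
      s = [:: 1%N] \/ (2 <= last 2 s)%N
    & x = cfrac R s].

(* Here a n is the partial quotient of index n + 1. *)
Definition infinite_regular_cf (R : realType) (a : nat -> nat) (x : R) : Prop :=
  (forall n, (0 < a n)%N) /\ cfrac R (mkseq a n) @[n --> \oo] --> x.

(* Every x in [0, 1] has exactly one regular expansion, finite (if x is
   rational) or infinite (if not), so it does not matter that the expansion is
   existentially quantified. *)
Definition cf_set (R : realType) (k : nat) : set R :=
  [set x | x \in `[0, 1] /\
    ((exists2 s, finite_regular_cf s x & all (fun a => k <= a)%N s) \/
     (exists2 a, infinite_regular_cf a x & forall n, (k <= a n)%N))].
Arguments cf_set : clear implicits.

(* Main.v *)
(* Fix t and write t = x + y with both expansions chosen simultaneously, digit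
   by digit. After n digits let q, q' and r, r' be the last two continuants of
   the two truncations; the defect t - x_n - y_n has sign (-1)^n and absolute
   value 1 / (q (q A + q')) = 1 / (r (r B + r')), i.e. it is made up for by the
   tail 1 / A in x alone, or by the tail 1 / B in y alone. The next digit of x
   is b = floor A + 1, so that part of the defect is left; the next digit of y
   is c = floor C, where 1 / C is the tail of y that would complete x_{n+1} to
   t. This overcompensates, so the sign flips. With theta = b - A, v = C - c
   and P = q A + q', the new parameters are
     A1 = P^2 / (r^2 theta^2 v) - 1 / theta   and   B1 = 1 / v.
   Digits stay >= k as long as A >= k - 1 and B >= 1, and A1 >= k - 1 follows
   from P^2 >= r^2 theta (theta (k - 1) + 1), an inequality that propagates.
   It holds at the start except when k = 2 and t is close to 1; for k = 2 and
   t > 5/6 both expansions are started with the digit 2 instead. *)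

Require Import Defs.
From mathcomp Require Import all_boot all_order all_algebra.
From mathcomp Require Import all_classical all_reals all_analysis.
From mathcomp Require Import ring lra.

Set Implicit Arguments.
Unset Strict Implicit.
Unset Printing Implicit Defensive.

Import Order.TTheory GRing.Theory Num.Theory.
Import numFieldNormedType.Exports.

Local Open Scope classical_set_scope.
Local Open Scope ring_scope.

(** * Real inequalities and identities for one step *)

(** As b - A <= 1, the last equation gives r (r C + r') >= (q A + q') (b q + q'). By the balance,
    this product is at least b r (r B + r') >= K r^2 + r r'. *)
Lemma next_digit_ge (R : realFieldType) (K q q' r r' A B b C : R) :
  0 < q -> 0 <= q' -> 0 < r -> 0 <= r' -> 1 <= K -> 0 < A -> 1 <= B ->
  A < b <= A + 1 -> K <= b ->
  r * (r * B + r') = q * (q * A + q') ->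
  (b - A) * (r * (r * C + r')) = (q * A + q') * (b * q + q') ->
  K <= C.
Proof.
move=> q0 q'0 r0 r'0 K1 A0 B1 /andP[Ab bA] Kb balance CE.
have P0 : 0 < q * A + q' by rewrite ltr_wpDr // mulr_gt0.
have b0 : 0 < b by lra.
have q10 : 0 < b * q + q' by rewrite ltr_wpDr // mulr_gt0.
have h1 : K * r ^+ 2 + r * r' <= (q * A + q') * (b * q + q').
  have -> : (q * A + q') * (b * q + q') =
      b * (r * (r * B + r')) + q' * (q * A + q') by rewrite balance; ring.
  have h2 : 0 <= q' * (q * A + q') by rewrite mulr_ge0 // ltW.
  have h3 : r ^+ 2 * K <= r ^+ 2 * (b * B).
    rewrite ler_pM2l ?exprn_gt0 //.
    have : 0 <= b * (B - 1) by rewrite mulr_ge0 ?(ltW b0) //; lra.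
    lra.
  have h4 : 0 <= r * r' * (b - 1) by rewrite !mulr_ge0 ?(ltW r0) //; lra.
  lra.
have th0 : 0 < b - A by lra.
have h5 : 0 < (b - A) * (r * (r * C + r')) by rewrite CE mulr_gt0.
have h6 : 0 <= (1 - (b - A)) * (r * (r * C + r')).
  rewrite mulr_ge0 //; first lra.
  by rewrite ltW // -(pmulr_rgt0 _ th0).
rewrite -(ler_pM2l (exprn_gt0 2 r0)).
lra.
Qed.

(* One step of the algorithm, with H = r C + r' and r1, q1 the new continuants. *)
Section Step.
Variables (R : realFieldType) (q r th v P q1 r1 H : R).
Hypotheses (q0 : 0 < q) (P0 : 0 < P) (r0 : 0 < r) (th0 : 0 < th).
Hypotheses (q10 : 0 < q1) (r10 : 0 < r1) (H0 : 0 < H).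
Hypotheses (q1E : q1 = P + q * th) (r1E : r1 = H - r * v).
Hypothesis HE : H = P * q1 / (r * th).

(** The digit of x leaves th / (P q1) = 1 / (r H), which the tail 1 / C of y would fill exactly;
    cutting C down to C - v overshoots. *)
Lemma step_gap : (q * P)^-1 - (q * q1)^-1 - (r * r1)^-1 = - (v / (r1 * H)).
Proof.
have -> : (q * P)^-1 - (q * q1)^-1 = (r * H)^-1.
  have q2 := q10; rewrite HE; rewrite q1E in q2 *; field.
  by rewrite !gt_eqF.
have h : r * v + r1 = H by rewrite r1E; ring.
have H2 := H0; rewrite -h in H2 *; field.
by rewrite !gt_eqF.
Qed.

Variable A1 : R.
Hypothesis v0 : 0 < v.
Hypothesis A1E : A1 = P ^+ 2 / (r ^+ 2 * th ^+ 2 * v) - th^-1.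

(** Shares its right-hand side, the reciprocal of the new gap, with [step_newB]: this is the balance
    of the next state. *)
Lemma step_newA : q1 * (q1 * A1 + q) = r1 * H / v.
Proof.
rewrite A1E r1E HE q1E; field.
by rewrite !gt_eqF.
Qed.

Lemma step_newB : r1 * (r1 * v^-1 + r) = r1 * H / v.
Proof. by rewrite r1E; field; rewrite gt_eqF. Qed.

Lemma step_newA_ge (K : R) :
  r ^+ 2 * th * v * (th * (K - 1) + 1) <= P ^+ 2 -> K - 1 <= A1.
Proof.
move=> large.
rewrite A1E lerBrDr ler_pdivlMr ?mulr_gt0 ?exprn_gt0 //.
apply: le_trans large; rewrite le_eqVlt; apply/orP; left; apply/eqP.
by field; rewrite gt_eqF.
Qed.

(** Expresses the next P^2 / r^2 without the old continuants, so that [step_large] yields the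
    propagated inequality. *)
Lemma step_square : (q1 * A1 + q) ^+ 2 = r1 ^+ 2 * ((A1 + th^-1) / v).
Proof.
have -> : (q1 * A1 + q) = r1 * (P / (r * th * v)).
  apply: (mulfI (lt0r_neq0 q10)); rewrite step_newA HE.
  by field; rewrite !gt_eqF.
by rewrite A1E; field; rewrite !gt_eqF.
Qed.

End Step.

(** The left side is at most K, since z <= 1, and K <= A + 1 / th. *)
Lemma step_large (R : realFieldType) (K A th v z : R) :
  1 <= K -> K - 1 <= A -> 0 < th <= 1 -> 0 < v <= 1 -> 0 <= z <= 1 ->
  z * (z * (K - 1) + 1) <= (A + th^-1) / v.
Proof.
move=> K1 KA /andP[th0 th1] /andP[v0 v1] /andP[z0 z1].
have h1 : 1 <= th^-1 by rewrite invf_ge1.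
rewrite ler_pdivlMr //.
have h2 : 0 <= (1 - z) * (1 + z) * (K - 1).
  by apply: mulr_ge0; [apply: mulr_ge0|]; lra.
have h3 : 0 <= (1 - v) * (z * (z * (K - 1) + 1)).
  by rewrite mulr_ge0 ?subr_ge0 // mulr_ge0 // addr_ge0 // mulr_ge0 // subr_ge0.
lra.
Qed.

(** * Continued fractions with a real tail *)

Section TailedFraction.
Variable R : realType.
Implicit Types (s : seq nat) (x y z : R) (k n : nat).

(** [z] is the reciprocal of the complete quotient following [s]; [z = 0] truncates. *)
Fixpoint cfrac_tail s z : R :=
  if s is a :: s' then (a%:R + cfrac_tail s' z)^-1 else z.

Lemma cfracE s : cfrac R s = cfrac_tail s 0.
Proof. by elim: s => //= a s ->. Qed.

Lemma cfrac_tail_cat s1 s2 z :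
  cfrac_tail (s1 ++ s2) z = cfrac_tail s1 (cfrac_tail s2 z).
Proof. by elim: s1 => //= a s ->. Qed.

Lemma cfrac_tail_rcons s a z :
  cfrac_tail (rcons s a) z = cfrac_tail s (a%:R + z)^-1.
Proof. by rewrite -cats1 cfrac_tail_cat. Qed.

Lemma cfrac_tail_ge0 s z : 0 <= z -> 0 <= cfrac_tail s z.
Proof. by move=> z0; elim: s => //= a s h; rewrite invr_ge0 addr_ge0. Qed.

Lemma cfrac_tail_le1 s z :
  all (leq 1) s -> 0 <= z <= 1 -> cfrac_tail s z <= 1.
Proof.
case: s => [|a s] /=; first by move=> _ /andP[].
move=> /andP[a1 _] /andP[z0 _].
have h := cfrac_tail_ge0 s z0.
have h1 : 1 <= a%:R :> R by rewrite ler1n.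
by rewrite invf_le1; lra.
Qed.

(** A digit a >= 2 scales distances by 1 / ((a + u) (a + w)) <= 1 / 2. *)
Lemma cfrac_tail_contract s x y : all (leq 2) s -> 0 <= x -> 0 <= y ->
  `|cfrac_tail s x - cfrac_tail s y| <= 2^-1 ^+ size s * `|x - y|.
Proof.
move=> + x0 y0; elim: s => [|a s IH] /=; first by rewrite mul1r.
move=> /andP[a2 /IH {}IH].
have hx := cfrac_tail_ge0 s x0; have hy := cfrac_tail_ge0 s y0.
have {}a2 : 2 <= a%:R :> R by rewrite ler_nat.
move: (cfrac_tail s x) (cfrac_tail s y) hx hy IH => u w u0 w0 IH.
have p1 : 0 < a%:R + u by lra.
have p2 : 0 < a%:R + w by lra.
have -> : (a%:R + u)^-1 - (a%:R + w)^-1 =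
    (w - u) * ((a%:R + u)^-1 * (a%:R + w)^-1).
  by field; rewrite !gt_eqF.
rewrite normrM distrC (ger0_norm (x := _ * _)); last first.
  by rewrite mulr_ge0 // invr_ge0 ltW.
have i1 : (a%:R + u)^-1 <= 2^-1 by rewrite lef_pV2 ?posrE //; lra.
have i2 : (a%:R + w)^-1 <= 1 by rewrite invf_le1 //; lra.
have j1 : 0 <= (a%:R + u)^-1 by rewrite invr_ge0 ltW.
have j2 : 0 <= (a%:R + w)^-1 by rewrite invr_ge0 ltW.
rewrite exprS -mulrA mulrC; apply: ler_pM => //; first exact: mulr_ge0.
by rewrite -[leRHS]mulr1 ler_pM.
Qed.

Lemma cvg_halfX : 2^-1 ^+ n @[n --> \oo] --> (0 : R).
Proof. by apply: cvg_expr; rewrite ger0_norm; lra. Qed.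

Lemma cfrac_mkseq_cvg (a : nat -> nat) : (forall n, (2 <= a n)%N) ->
  cvg (cfrac R (mkseq a n) @[n --> \oo]).
Proof.
move=> a2; apply: cauchy_cvg; apply: cauchy_exP => e e0.
have [N _ HN] := @cvgr0_norm_lt _ _ _ _ _ _ cvg_halfX _ e0.
exists (cfrac R (mkseq a N)); exists N => // n /= Nn.
(* A longer truncation is the N-th one with some tail in [0, 1], hence within 2^-N of it. *)
rewrite -ball_normE /= !cfracE.
have -> : mkseq a n = mkseq a N ++ mkseq (fun i => a (N + i)%N) (n - N).
  rewrite -{1}(subnKC Nn) /mkseq iotaD map_cat add0n; congr cat.
  by rewrite -{1}[N]addn0 iotaDl -map_comp.
rewrite cfrac_tail_cat.
have all2 b m : (forall i, (2 <= b i)%N) -> all (leq 2) (mkseq b m).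
  by move=> H; apply/allP => _ /mapP[i _ ->].
set z := cfrac_tail (mkseq (fun i => a (N + i)%N) _) 0.
have z0 : 0 <= z by apply: cfrac_tail_ge0.
have z1 : z <= 1.
  apply: cfrac_tail_le1; last by rewrite lexx ler01.
  by apply: sub_all (all2 _ _ _) => // i; apply: ltnW.
apply: (le_lt_trans (cfrac_tail_contract (all2 _ _ a2) (lexx 0) z0)).
rewrite size_mkseq; have := HN N (leqnn _) => /=.
rewrite sub0r normrN (ger0_norm z0) ger0_norm ?exprn_ge0 ?invr_ge0 //.
apply: le_lt_trans; rewrite -[leRHS]mulr1 ler_wpM2l // exprn_ge0 // invr_ge0.
Qed.

(* [q] and [q'] are the last two continuants of [s], and [e] is the sign
   (-1)^(size s). *)
Definition tail_variation s e q q' := forall z, 0 <= z ->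
  cfrac_tail s z = cfrac_tail s 0 + e * (z / (q * (q + q' * z))).

Lemma tail_variation_rcons s e q q' a : (0 < a)%N -> 0 < q -> 0 <= q' ->
  tail_variation s e q q' ->
  tail_variation (rcons s a) (- e) (a%:R * q + q') q.
Proof.
move=> a0 q0 q'0 H z z0; rewrite !cfrac_tail_rcons.
have {}a0 : 0 < a%:R :> R by rewrite ltr0n.
have az : 0 < a%:R + z by lra.
rewrite addr0 (H (a%:R + z)^-1) ?invr_ge0 ?ltW // (H a%:R^-1) ?invr_ge0 ?ltW //.
have p1 : 0 < q * (a%:R + z) + q' by rewrite ltr_wpDr // mulr_gt0.
have p2 : 0 < q * a%:R + q' by rewrite ltr_wpDr // mulr_gt0.
have p3 : 0 < a%:R * q + q' by rewrite mulrC.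
have p4 : 0 < a%:R * q + q' + q * z by rewrite ltr_wpDr // mulr_ge0 // ltW.
by field; rewrite !gt_eqF.
Qed.

Lemma cfrac_rcons s e q q' a : (0 < a)%N -> 0 < q -> 0 <= q' ->
  tail_variation s e q q' ->
  cfrac R (rcons s a) = cfrac R s + e * (q * (a%:R * q + q'))^-1.
Proof.
move=> a0 q0 q'0 H; rewrite !cfracE cfrac_tail_rcons addr0.
have {}a0 : 0 < a%:R :> R by rewrite ltr0n.
rewrite H ?invr_ge0 ?ltW //.
have p2 : 0 < q * a%:R + q' by rewrite ltr_wpDr // mulr_gt0.
have p3 : 0 < a%:R * q + q' by rewrite mulrC.
by field; rewrite !gt_eqF.
Qed.

End TailedFraction.

(** * From simultaneous refinement to membership in the sumset *)

Section Sumset.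
Variable R : realType.
Implicit Types (s : seq nat) (k : nat) (t : R).

Lemma cf_set_finite k s : (2 <= k)%N -> all (leq k) s -> cf_set R k (cfrac R s).
Proof.
move=> k2 ks.
have k1 : (1 <= k)%N by apply: ltnW.
have s1 : all (leq 1) s by apply: sub_all ks => i; apply: leq_trans.
split.
  rewrite in_itv /= cfracE cfrac_tail_ge0 // cfrac_tail_le1 //.
  by rewrite lexx ler01.
(* Since k >= 2, no last digit is 1; the empty expansion passes by the default of [last]. *)
left; exists s => //; split => //; right.
case/lastP: s ks {s1} => //= s a.
by rewrite last_rcons all_rcons => /andP[ka _]; apply: leq_trans ka.
Qed.

Lemma cf_set_infinite k (a : nat -> nat) : (2 <= k)%N ->
  (forall n, (k <= a n)%N) -> cf_set R k (lim (cfrac R (mkseq a n) @[n --> \oo])).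
Proof.
move=> k2 ka.
have a2 n : (2 <= a n)%N by apply: leq_trans (ka n).
have cv := @cfrac_mkseq_cvg R a a2.
split; last first.
  right; exists a => //; split => // n; exact: ltnW.
have s1 n : all (leq 1) (mkseq a n).
  by apply/allP => _ /mapP[i _ ->]; apply: ltnW.
rewrite in_itv /=; apply/andP; split.
  apply: limr_ge => //; near=> n.
  by rewrite cfracE cfrac_tail_ge0.
apply: limr_le => //; near=> n.
by rewrite cfracE cfrac_tail_le1 // lexx ler01.
Unshelve. all: by end_near.
Qed.

(** If no two finite expansions sum to t, the steps never stop; the digits chosen define two
    infinite expansions, whose truncations sum to t in the limit by the closeness bound. *)
Lemma sum_of_refinements k t (inv : seq nat -> seq nat -> Prop) : (2 <= k)%N ->
  inv [::] [::] ->
  (forall s s', all (leq k) s -> inv s s' ->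
     `|t - (cfrac R s + cfrac R s')| <= 2^-1 ^+ size s) ->
  (forall s s', inv s s' -> exists b c : nat,
     [/\ (k <= b)%N, (k <= c)%N &
       t = cfrac R (rcons s b) + cfrac R (rcons s' c) \/
       inv (rcons s b) (rcons s' c)]) ->
  [set c + b | c in cf_set R k & b in cf_set R k] t.
Proof.
move=> k2 inv0 close step.
have [[s [s' [ks ks' ->]]]|nfin] := pselect (exists s s',
    [/\ all (leq k) s, all (leq k) s' & t = cfrac R s + cfrac R s']).
  exists (cfrac R s); first exact: cf_set_finite.
  by exists (cfrac R s') => //; apply: cf_set_finite.
pose ok p := [/\ all (leq k) p.1, all (leq k) p.2 & inv p.1 p.2].
pose next (p : seq nat * seq nat) (d : nat * nat) :=
  (rcons p.1 d.1, rcons p.2 d.2).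
have /choice[h hP] p : exists d, ok p -> ok (next p d).
  have [[kp1 kp2 ip]|np] := pselect (ok p); last by exists (0%N, 0%N).
  have [b [c [kb kc H]]] := step _ _ ip.
  exists (b, c) => _; rewrite /ok /= !all_rcons kb kc kp1 kp2; split=> //.
  case: H => // tE; case: nfin; exists (rcons p.1 b), (rcons p.2 c).
  by rewrite !all_rcons kb kc kp1 kp2.
pose P n := iter n (fun p => next p (h p)) ([::], [::]).
pose a n := (h (P n)).1; pose b n := (h (P n)).2.
have PE n : P n = (mkseq a n, mkseq b n).
  by elim: n => // n IH; rewrite !mkseqS [LHS]/= -/(P n) /next {1 3}IH.
have Pok n : ok (P n) by elim: n => //= n; apply: hP.
have ka n : (k <= a n)%N.
  by have [+ _ _] := Pok n.+1; rewrite PE !mkseqS /= all_rcons => /andP[].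
have kb n : (k <= b n)%N.
  by have [_ + _] := Pok n.+1; rewrite PE !mkseqS /= all_rcons => /andP[].
have cva : cvg (cfrac R (mkseq a n) @[n --> \oo]).
  by apply: cfrac_mkseq_cvg => n; apply: leq_trans (ka n).
have cvb : cvg (cfrac R (mkseq b n) @[n --> \oo]).
  by apply: cfrac_mkseq_cvg => n; apply: leq_trans (kb n).
exists (lim (cfrac R (mkseq a n) @[n --> \oo])).
  exact: cf_set_infinite.
exists (lim (cfrac R (mkseq b n) @[n --> \oo])).
  exact: cf_set_infinite.
have cvs : cfrac R (mkseq a n) + cfrac R (mkseq b n) @[n --> \oo] -->
    lim (cfrac R (mkseq a n) @[n --> \oo]) + lim (cfrac R (mkseq b n) @[n --> \oo]).
  exact: cvgD.
have cvt : cfrac R (mkseq a n) + cfrac R (mkseq b n) @[n --> \oo] --> t.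
  apply/cvgrPdist_le => e e0.
  have [N _ HN] := @cvgr0_norm_le _ _ _ _ _ _ (@cvg_halfX R) _ e0.
  exists N => // n /HN /=; rewrite ger0_norm ?exprn_ge0 ?invr_ge0 //.
  apply: le_trans; have [ks _ ip] := Pok n.
  move: ks ip; rewrite PE /= => ks ip.
  by have := close _ _ ks ip; rewrite size_mkseq.
exact: cvg_unique cvs cvt.
Qed.

(* The points [cfrac s] and [cfrac s'] face each other across a gap of length
   1 / (q (q A + q')) whose other end is reached from [cfrac s] by the tail 1 / A
   and from [cfrac s'] by the tail 1 / B. *)
Definition linked k t s s' : Prop :=
  exists (e q q' r r' A B : R),
  [/\ [/\ `|e| = 1, 0 < q, 0 <= q', 0 < r & 0 <= r'],
      tail_variation s e q q', tail_variation s' e r r',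
      [/\ k%:R - 1 <= A, 1 <= B,
          r * (r * B + r') = q * (q * A + q')
        & t = cfrac R s + cfrac R s' + e * (q * (q * A + q'))^-1]
    & forall b : nat, A < b%:R <= A + 1 ->
        r ^+ 2 * ((b%:R - A) * ((b%:R - A) * (k%:R - 1) + 1)) <=
          (q * A + q') ^+ 2].

(** * Linked pairs: closeness, propagation, starting states *)

(** The gap is the effect of the tail 1 / A <= 1 on [s], so the contraction applies. *)
Lemma linked_close k t s s' : (2 <= k)%N -> all (leq k) s -> linked k t s s' ->
  `|t - (cfrac R s + cfrac R s')| <= 2^-1 ^+ size s.
Proof.
move=> k2 ks [e [q [q' [r [r' [A [B [[e1 q0 q'0 r0 r'0] vs _ [kA _ _ tE] _]]]]]]]].
have {}k2' : 2 <= k%:R :> R by rewrite ler_nat.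
have A1 : 1 <= A by lra.
have A0 : 0 < A by lra.
have P0 : 0 < q * A + q' by rewrite ltr_wpDr // mulr_gt0.
have Ai0 : 0 <= A^-1 by rewrite invr_ge0 ltW.
have -> : t - (cfrac R s + cfrac R s') = cfrac_tail s A^-1 - cfrac_tail s 0.
  by rewrite tE vs //; field; rewrite !gt_eqF.
have s2 : all (leq 2) s by apply: sub_all ks => i; apply: leq_trans.
apply: le_trans (cfrac_tail_contract s2 Ai0 (lexx 0)) _.
rewrite subr0 ger0_norm // -[leRHS]mulr1 ler_wpM2l ?exprn_ge0 ?invr_ge0 //.
by rewrite invf_le1.
Qed.

Lemma linked_step k t s s' : (2 <= k)%N -> linked k t s s' -> exists b c : nat,
  [/\ (k <= b)%N, (k <= c)%N &
    t = cfrac R (rcons s b) + cfrac R (rcons s' c) \/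
    linked k t (rcons s b) (rcons s' c)].
Proof.
move=> k2 [e [q [q' [r [r' [A [B [[e1 q0 q'0 r0 r'0] vs vs' [kA B1 bal tE] large]]]]]]]].
have K2 : 2 <= k%:R :> R by rewrite ler_nat.
have K1 : 1 <= k%:R :> R by lra.
have A0 : 0 < A by lra.
have := truncn_itv (ltW A0).
set b := (Num.truncn A).+1 => /andP[bA Ab].
have {}bA : A < b%:R <= A + 1 by rewrite Ab /= -natr1 lerD2r.
have k0 : (0 < k)%N by apply: ltnW.
have kb : (k <= b)%N.
  by rewrite -(prednK k0) /b ltnS truncn_ge_nat ?(ltW A0) // -subn1 natrB.
have kb' : k%:R <= b%:R :> R by rewrite ler_nat.
pose P := q * A + q'; pose q1 := b%:R * q + q'; pose th := b%:R - A.
have b0 : 0 < b%:R :> R by lra.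
have P0 : 0 < P by rewrite ltr_wpDr // mulr_gt0.
have q10 : 0 < q1 by rewrite ltr_wpDr // mulr_gt0.
have th0 : 0 < th by rewrite subr_gt0.
have th1 : th <= 1 by rewrite /th; lra.
pose C := (P * q1 / th / r - r') / r.
have CE : th * (r * (r * C + r')) = P * q1.
  by rewrite /C; field; rewrite !gt_eqF.
have kC : k%:R <= C := next_digit_ge q0 q'0 r0 r'0 K1 A0 B1 bA kb' bal CE.
have C0 : 0 <= C by lra.
have := truncn_itv C0; set c := Num.truncn C => /andP[cC Cc].
have kc : (k <= c)%N by rewrite /c truncn_ge_nat.
have c0 : 0 < c%:R :> R by rewrite ltr0n (leq_trans _ kc) // ltnW.
pose v := C - c%:R; pose r1 := c%:R * r + r'; pose H := r * C + r'.
have v0 : 0 <= v by rewrite subr_ge0.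
have v1 : v <= 1 by rewrite /v; rewrite -natr1 in Cc; lra.
have r10 : 0 < r1 by rewrite ltr_wpDr // mulr_gt0.
have H0 : 0 < H by rewrite ltr_wpDr // mulr_gt0 //; lra.
have q1E : q1 = P + q * th by rewrite /q1 /P /th; ring.
have r1E : r1 = H - r * v by rewrite /r1 /H /v; ring.
have HE : H = P * q1 / (r * th) by rewrite -CE /H; field; rewrite !gt_eqF.
have gap := step_gap q0 P0 r0 th0 q10 r10 H0 q1E r1E HE.
have b_gt0 : (0 < b)%N by [].
have c_gt0 : (0 < c)%N by rewrite -(ltr_nat R).
have xE := cfrac_rcons b_gt0 q0 q'0 vs.
have yE := cfrac_rcons c_gt0 r0 r'0 vs'.
have {}tE : t = cfrac R (rcons s b) + cfrac R (rcons s' c) + (- e) * (v / (r1 * H)).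
  rewrite mulNr -mulrN -gap xE yE tE -/P -/q1 -/r1; ring.
exists b, c; split => //.
have [v_eq0|v_neq0] := eqVneq v 0.
  by left; rewrite tE v_eq0 mul0r mulr0 addr0.
have {v_neq0}v0 : 0 < v by rewrite lt_def v_neq0.
right.
pose A1 := P ^+ 2 / (r ^+ 2 * th ^+ 2 * v) - th^-1.
have newA := step_newA r0 th0 q1E r1E HE v0 (erefl A1).
have newB := step_newB r1E v0.
have large' : r ^+ 2 * th * v * (th * (k%:R - 1) + 1) <= P ^+ 2.
  apply: le_trans (large b bA).
  have : 0 <= (1 - v) * (r ^+ 2 * (th * (th * (k%:R - 1) + 1))).
    rewrite mulr_ge0 ?subr_ge0 // mulr_ge0 ?exprn_ge0 ?(ltW r0) //.
    by rewrite mulr_ge0 ?(ltW th0) // addr_ge0 // mulr_ge0 ?(ltW th0) // subr_ge0.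
  rewrite -/th; lra.
have A1_ge := step_newA_ge r0 th0 v0 (erefl A1) large'.
exists (- e), q1, q, r1, r, A1, v^-1; split.
- by rewrite normrN; split => //; apply: ltW.
- exact: tail_variation_rcons.
- exact: tail_variation_rcons.
- split => //; first by rewrite invf_ge1.
    by rewrite newA newB.
  by rewrite tE newA invf_div.
- move=> d dA.
  rewrite (step_square r0 th0 q10 q1E r1E HE v0 (erefl A1)).
  rewrite ler_pM2l ?exprn_gt0 //; apply: step_large => //.
  + by rewrite th0.
  + by rewrite v0.
  + by lra.
Qed.

Lemma linked_nil k t : (2 <= k)%N -> 0 < t <= 1 / (k%:R - 1) ->
  t <= 5 / 6 \/ (3 <= k)%N -> linked k t [::] [::].
Proof.
move=> k2 /andP[t0 tk] hyp.
have K2 : 2 <= k%:R :> R by rewrite ler_nat.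
have kA : k%:R - 1 <= t^-1.
  rewrite -(ler_pM2r t0) mulVf ?gt_eqF // mulrC -ler_pdivlMr //; lra.
have vnil : tail_variation [::] 1 1 (0 : R).
  by move=> z z0 /=; rewrite mul0r addr0 !mul1r divr1 add0r.
exists 1, 1, 0, 1, 0, t^-1, t^-1; split => //.
- by rewrite normr1; split.
- split => //; first lra.
  by rewrite /= !(addr0, mul1r, add0r) invrK.
- have large (z : R) : 2 <= t^-1 -> 0 < z <= 1 ->
      z * (z * (k%:R - 1) + 1) <= t^-1 ^+ 2.
    move=> A2 /andP[z0 z1].
    have h1 : 0 <= (1 - z) * (1 + z) * (k%:R - 1).
      by apply: mulr_ge0; [apply: mulr_ge0|]; lra.
    have h2 : 0 <= (t^-1 - (k%:R - 1)) * t^-1 by apply: mulr_ge0; lra.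
    have h3 : 0 <= (t^-1 - 2) * (k%:R - 1) by apply: mulr_ge0; lra.
    lra.
  move=> b /andP[Ab bA]; rewrite expr1n !mul1r addr0.
  have [A2|A2] := leP 2 t^-1; first by apply: large => //; lra.
  case: hyp => [t5|k3]; last first.
    have K3 : 3 <= k%:R :> R by rewrite ler_nat.
    lra.
  (* The source of 5/6: with k = b = 2 and A = 1 / t, the goal (2 - A) (3 - A) <= A^2 says 6 <= 5
     A. *)
  have A6 : 6 / 5 <= t^-1.
    by rewrite -(ler_pM2r t0) mulVf ?gt_eqF //; lra.
  have b2 : b = 2%N.
    apply/eqP; rewrite eqn_leq -ltnS -!(ltr_nat R); lra.
  have k2E : k = 2%N.
    by apply/eqP; rewrite eqn_leq k2 andbT -ltnS -(ltr_nat R); lra.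
  rewrite b2 k2E.
  lra.
Qed.

Lemma linked_2 t : 5 / 6 < t < 1 -> linked 2 t [:: 2%N] [:: 2%N].
Proof.
move=> /andP[t5 t1].
have v2 : tail_variation [:: 2%N] (- 1) 2 (1 : R).
  by move=> z z0 /=; field; rewrite !gt_eqF //; lra.
(* Solves 1 / (2 (2 A + 1)) = 1 - t, the excess of 1/2 + 1/2 over t; A >= 1 holds exactly when t >=
   5/6. *)
pose A := (4 * (1 - t))^-1 - 1 / 2.
have u0 : 0 < 4 * (1 - t) by lra.
have A1 : 1 <= A.
  by rewrite /A lerBrDr -(ler_pM2r u0) mulVf ?gt_eqF //; lra.
exists (- 1), 2, 1, 2, 1, A, A; split => //.
- by rewrite normrN normr1; split; lra.
- split => //; first lra.
  rewrite /A /=; field; rewrite !gt_eqF //; lra.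
- move=> b /andP[Ab bA].
  have h1 : 0 <= (1 - (b%:R - A)) * (2 + (b%:R - A)) by apply: mulr_ge0; lra.
  have h2 : 0 <= (A - 1) * (A + 2) by apply: mulr_ge0; lra.
  lra.
Qed.

End Sumset.

(** * The interval inclusion and the measure bound *)

Theorem theorem1 (R : realType) (k : nat) (hk : (2 <= k)%N) :
  `[0, 1 / (k%:R - 1)] `<=` [set c + b | c in cf_set R k & b in cf_set R k] /\
  ((1 / (k%:R - 1))%:E <=
     lebesgue_measure [set (c + b)%R | c in cf_set R k & b in cf_set R k])%E.
Proof.
have K2 : 2 <= k%:R :> R by rewrite ler_nat.
have sub : `[0, 1 / (k%:R - 1)] `<=`
    [set c + b | c in cf_set R k & b in cf_set R k]; last first.
  split=> //.
  have <- : lebesgue_measure `[0, 1 / (k%:R - 1) : R] = (1 / (k%:R - 1))%:E.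
    rewrite lebesgue_measure_itv /= lte_fin divr_gt0 ?subr_gt0 //; last lra.
    by rewrite sube0.
  (* Monotonicity as an outer measure, valid for arbitrary sets. *)
  exact: le_mu_ext.
move=> t; rewrite /= in_itv /= => /andP[t0 tk].
have [->|t_neq0] := eqVneq t 0.
  have n0 : cf_set R k (0 : R) by have := @cf_set_finite R k [::] hk isT.
  by exists 0 => //; exists 0 => //; rewrite addr0.
have {t_neq0}t0 : 0 < t by rewrite lt_def t_neq0.
(* The empty start for k = 2 and t > 5/6. Its one step appends 2 to both sides, which is exact for t
   = 1 and gives a linked pair for t < 1. *)
pose special (s s' : seq nat) := [/\ k = 2%N, s = [::], s' = [::] & 5 / 6 < t <= 1].
apply: (@sum_of_refinements R k t (fun s s' => linked k t s s' \/ special s s')) => //.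
- have [t5|t5] := leP t (5 / 6).
    by left; apply: linked_nil => //; [rewrite t0|left].
  have [k3|] := ltnP 2 k.
    by left; apply: linked_nil => //; [rewrite t0|right].
  move=> k2; have k2E : k = 2%N by apply/eqP; rewrite eqn_leq k2.
  right; split => //; rewrite t5 /=.
  apply: le_trans tk _; rewrite k2E div1r invf_le1; lra.
- move=> s s' ks [|[_ -> -> t1]]; first exact: linked_close.
  by rewrite /= addr0 subr0 ger0_norm; lra.
- move=> s s' [|[k2 -> -> /andP[t5 t1]]]; first
    by move/(linked_step hk) => [b [c [kb kc [|]]]]; exists b, c; split=> //; tauto.
  exists 2%N, 2%N; rewrite k2; split => //.
  have [->|tn1] := eqVneq t 1; first by left; rewrite /=; field.
  right; left; apply: linked_2; rewrite t5 lt_def t1 andbT eq_sym //.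
Qed.
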